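(* Let $\Lambda=\mathbb Z^3$ with height function $h(i)=-i_3$, $m=2$, $\varphi_1(x)=x(0,0,-1)\vee[x(0,1,-1)\wedge x(1,0,-1)]$, $\varphi_2(x)=x(0,0,-1)$, and for $r\in(0,1]$ let $\mathbf r(1)=r$, $\mathbf r(2)=1-r$. Write $\overline\rho(p,r)$ for the density $\overline\rho(p)$ of the maximal trajectory of the associated random monotone cellular automaton. Then: (i) $\lim_{p\to0}\overline\rho(p,r)=1$ for each $r\in(0,1]$; (ii) there exists a constant $c>0$ such that $\overline\rho(p,r)\to1$ whenever $r\to0$ and $p\to 0$ with $0\le p\le cr^2$; that is, for every $\epsilon>0$ there is $\delta>0$ such that $\overline\rho(p,r)\ge1-\epsilon$ for all $0<r<\delta$ and $0\le p\le cr^2$.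
   Context: Setting of random monotone cellular automata: $\Lambda$ a countable group (here $\mathbb Z^3$ with addition); a height function is a group homomorphism $h:\Lambda\to\mathbb Z$. $\varphi_0$ is the constant-zero map; $\varphi_1,\dots,\varphi_m$ are non-constant local monotone maps $\{0,1\}^\Lambda\to\{0,1\}$ depending only on coordinates in $\{i:h(i)=1\}$; $\mathbf r$ is a probability distribution on $\{1,\dots,m\}$; $(\mu(i))_{i\in\Lambda}$ i.i.d. with $\mathbb P[\mu(i)=0]=p$, $\mathbb P[\mu(i)=k]=(1-p)\mathbf r(k)$; $\Phi^p_i(x):=\varphi_{\mu(i)}((x(ij))_j)$. A trajectory is $x$ with $x(i)=\Phi^p_i(x)$ for all $i$; $\overline X^p$ is the maximal trajectory and $\overline\rho(p):=\mathbb P[\overline X^p(i)=1]$ (independent of $i$). *)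

(* Defs.v *)
From HB Require Import structures.
From mathcomp Require Import all_boot all_order all_algebra.
From mathcomp Require Import all_classical all_reals all_analysis.
Set Implicit Arguments. Unset Strict Implicit. Unset Printing Implicit Defensive.
Import Order.TTheory GRing.Theory Num.Theory.
Local Open Scope classical_set_scope.
Local Open Scope ring_scope.

Definition site := (int * int * int)%type.
Definition sadd (i j : site) : site :=
  (i.1.1 + j.1.1, i.1.2 + j.1.2, i.2 + j.2).
Definition site0 : site := (0, 0, 0).

Definition config := site -> bool.

(* Local maps phi_0 (constant 0), phi_1, phi_2, read at site i through the
   shifted configuration j |-> x (i j). The offsets j all have height
   h(j) = - j_3 = 1. *)
Definition phi (k : 'I_3) (x : config) (i : site) : bool :=
  match val k with
  | 0 => false
  | 1 => x (sadd i (0, 0, -1)) ||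
         (x (sadd i (0, 1, -1)) && x (sadd i (1, 0, -1)))
  | _ => x (sadd i (0, 0, -1))
  end.

Definition law {R : realType} (p r : R) (k : 'I_3) : R :=
  match val k with
  | 0 => p
  | 1 => (1 - p) * r
  | _ => (1 - p) * (1 - r)
  end.

Definition iid_field {R : realType} (d : measure_display) (Omega : measurableType d)
    (P : probability Omega R) (mu : site -> Omega -> 'I_3) (p r : R) : Prop :=
  (forall i k, measurable (mu i @^-1` [set k])) /\
  (forall (S : seq site) (v : site -> 'I_3), uniq S ->
     P (\bigcap_(i in [set` S]) (mu i @^-1` [set v i])) =
     (\prod_(i <- S) law p r (v i))%:E).

Definition trajectory {T : Type} (mu : site -> T -> 'I_3) (w : T) (x : config) :
  Prop := forall i, x i = phi (mu i w) x i.

Definition max_trajectory {T : Type} (mu : site -> T -> 'I_3) (w : T) (x : config) :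
  Prop := trajectory mu w x /\ forall y, trajectory mu w y -> forall i, y i ==> x i.

Definition top_event {T : Type} (mu : site -> T -> 'I_3) : set T :=
  [set w | exists x, max_trajectory mu w x /\ x site0].

Definition rho_ge {R : realType} (p r a : R) : Prop :=
  forall (d : measure_display) (Omega : measurableType d)
    (P : probability Omega R) (mu : site -> Omega -> 'I_3),
    iid_field P mu p r -> (a%:E <= P (top_event mu))%E.

(* Main.v *)
(** A site is 0 in the maximal trajectory iff it is 0 after finitely many steps
    started from all ones. Cut time into blocks of length K of order 1/r and call
    a block (v, k) bad if it contains an error or no application of phi_1. If v is
    0 at some time of a block k, and neither (v, k) nor (v, k - 1) is bad, then v
    and one of its two neighbours v + e are 0 during block k - 1. Unfolding this
    recursively produces a closed walk in the space of blocks with steps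
    (e, -1), (-e, 0), (0, 1), and marks at bad blocks; since (e, -1) and (-e, 0)
    must balance, and a mark separates any two steps (-e, 0), its length is at
    most 5 times the number of marks. Cutting out the loop between two marks at
    the same block makes the marked blocks distinct, hence independent, and a
    Peierls sum over walks finishes the proof: a block is bad with probability at
    most K p + ((1 - p) (1 - r)) ^ K, which is small as soon as p / r is. *)

Require Import Defs.
From HB Require Import structures.
From mathcomp Require Import all_boot all_order all_algebra.
From mathcomp Require Import all_classical all_reals all_analysis.
From mathcomp Require Import zify lra.
Set Implicit Arguments.
Unset Strict Implicit.
Unset Printing Implicit Defensive.
Import Order.TTheory GRing.Theory Num.Theory.
Local Open Scope ring_scope.

(** * Marked walks in the space of blocks *)

(* The first two booleans give the kind of move (see [down], [mark], [up],
   [slide]); the third selects the direction of [down] and [slide], or whether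
   [mark] descends one level before marking. It is a junk bit for [up]. *)
Definition letter := (bool * bool * bool)%type.
Definition down (b : bool) : letter := (false, false, b).
Definition mark (b : bool) : letter := (false, true, b).
Definition up : letter := (true, false, false).
Definition slide (b : bool) : letter := (true, true, b).

Definition is_down (l : letter) := ~~ l.1.1 && ~~ l.1.2.
Definition is_mark (l : letter) := ~~ l.1.1 && l.1.2.
Definition is_up (l : letter) := l.1.1 && ~~ l.1.2.
Definition is_slide (l : letter) := l.1.1 && l.1.2.

Definition side (b : bool) : site := if b then (1, 0, 0) else (0, 1, 0).

Definition step (l : letter) : site :=
  let: (k1, k2, b) := l in
  match k1, k2 with
  | false, false => sadd (side b) (0, 0, -1)
  | false, true => (0, 0, - (b : nat)%:Z)
  | true, false => (0, 0, 1)
  | true, true => (- (side b).1.1, - (side b).1.2, 0)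
  end.

Definition walk (x : site) (w : seq letter) : site :=
  foldl (fun y l => sadd y (step l)) x w.

Fixpoint marks (x : site) (w : seq letter) : seq site :=
  if w is l :: w' then
    let y := sadd x (step l) in
    if is_mark l then y :: marks y w' else marks y w'
  else [::].

(* Automaton recognising [(down* mark up* slide)* down* mark up*]; the state
   [Some b] records whether a mark has been met since the last slide. *)
Definition next (s : option bool) (l : letter) : option bool :=
  if s is Some b then
    if is_down l then (if b then None else Some false)
    else if is_mark l then (if b then None else Some true)
    else if is_up l then (if b then Some true else None)
    else (if b then Some false else None)
  else None.

Definition state (s : option bool) (w : seq letter) := foldl next s w.

Definition contour (x : site) (w : seq letter) : bool :=
  (state (Some false) w == Some true) && (walk x w == x).

(** * Length of a closed walk against its number of marks *)

Lemma walk_cat x w1 w2 : walk x (w1 ++ w2) = walk (walk x w1) w2.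
Proof. exact: foldl_cat. Qed.

Lemma state_cat s w1 w2 : state s (w1 ++ w2) = state (state s w1) w2.
Proof. exact: foldl_cat. Qed.

Lemma state_None w : state None w = None.
Proof. by elim: w. Qed.

Lemma marks_cat x w1 w2 :
  marks x (w1 ++ w2) = marks x w1 ++ marks (walk x w1) w2.
Proof. by elim: w1 x => //= l w IH x; case: (is_mark l); rewrite IH. Qed.

Lemma size_marks x w : size (marks x w) = count is_mark w.
Proof. by elim: w x => //= l w IH x; case: (is_mark l); rewrite /= IH. Qed.

(** The bit of the state is raised by every mark and cleared by every slide, and neither can occur
    twice in a row; a contour thus has one mark more than slides. *)
Lemma state_count b b' w : state (Some b) w = Some b' ->
  (count is_mark w + b = count is_slide w + b')%N.
Proof.
elim: w b => [|l w IH] b /=; first by case=> ->.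
case: l => -[[] []] c; case: b; rewrite /next /= -/(state _ _) ?state_None //;
  by move/IH; rewrite /is_mark /is_slide /=; lia.
Qed.

(** Raised by 1 by [down], lowered by 1 by [slide], unchanged by the other letters. *)
Definition level (x : site) : int := x.1.1 + x.1.2.

Lemma level_walk x w : level (walk x w) =
  level x + (count is_down w)%:Z - (count is_slide w)%:Z.
Proof.
elim: w x => [|l w IH] x /=; first by lia.
rewrite IH; move: (count is_down w) (count is_slide w) => m n.
case: l => [[[] []] []];
  by rewrite /level /sadd /= /is_down /is_slide /=; lia.
Qed.

(** Here [d] counts the marks that descend one level. *)
Lemma height_walk x w : exists2 d : nat, (d <= count is_mark w)%N &
  (walk x w).2 = x.2 + (count is_up w)%:Z - (count is_down w)%:Z - d%:Z.
Proof.
elim: w x => [|l w IH] x /=; first by exists 0%N => //; lia.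
have [d led ->] := IH (sadd x (step l)).
move: (count is_mark w) (count is_up w) (count is_down w) led => m n k led.
case: l => [[[] []] []];
  rewrite /sadd /= /is_down /is_slide /is_up /is_mark /=;
  try (by exists d; lia); by exists d.+1; lia.
Qed.

Lemma size_kinds w : size w =
  (count is_down w + count is_mark w + count is_up w + count is_slide w)%N.
Proof.
elim: w => //= l w ->.
move: (count is_mark w) (count is_up w) (count is_down w) => m n k.
move: (count is_slide w) => j.
by case: l => [[[] []] b];
  rewrite /is_down /is_mark /is_up /is_slide /=; lia.
Qed.

(** With n marks there are n - 1 slides, hence n - 1 downs by [level], and at most 2n - 1 ups by
    height. *)
Lemma contour_size x w : contour x w -> (size w <= 5 * size (marks x w))%N.
Proof.
case/andP=> /eqP /state_count sw /eqP cw; rewrite size_marks size_kinds.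
have := level_walk x w; have [d] := height_walk x w; rewrite cw; lia.
Qed.

Lemma contour_gt0 x w : contour x w -> (0 < size w)%N.
Proof. by case: w. Qed.

(** * Removal of repeated marks *)

Lemma mem_marks x y w : y \in marks x w -> exists w1 b w2,
  w = rcons w1 (mark b) ++ w2 /\ walk x (rcons w1 (mark b)) = y.
Proof.
elim: w x => //= l w IH x.
have tail : y \in marks (sadd x (step l)) w -> exists w1 b w2,
  l :: w = rcons w1 (mark b) ++ w2 /\ walk x (rcons w1 (mark b)) = y.
  by move=> /IH[w1 [b [w2 [-> h]]]]; exists (l :: w1), b, w2.
case ml: (is_mark l) => //; rewrite inE => /orP[/eqP -> |//].
by exists [::], l.2, w; split => //; case: l ml {tail} => [[[] []] []].
Qed.

Lemma marks_nuniq x w : ~~ uniq (marks x w) -> exists w1 b w2 b' w3,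
  w = rcons w1 (mark b) ++ rcons w2 (mark b') ++ w3 /\
  walk (walk x (rcons w1 (mark b))) (rcons w2 (mark b')) =
  walk x (rcons w1 (mark b)).
Proof.
elim: w x => //= l w IH x.
have tail : ~~ uniq (marks (sadd x (step l)) w) -> exists w1 b w2 b' w3,
  l :: w = rcons w1 (mark b) ++ rcons w2 (mark b') ++ w3 /\
  walk (walk x (rcons w1 (mark b))) (rcons w2 (mark b')) =
  walk x (rcons w1 (mark b)).
  move=> /IH[w1 [b [w2 [b' [w3 [-> h]]]]]].
  by exists (l :: w1), b, w2, b', w3.
case ml: (is_mark l) => //=; rewrite negb_and => /orP[|//].
rewrite negbK => /mem_marks[w2 [b' [w3 [-> h]]]].
exists [::], l.2, w2, b', w3.
by split; case: l ml h {tail} => [[[] []] b].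
Qed.

(* The automaton is in state [Some true] after every mark, so the loop between two
   marks at the same site can be cut out. *)
Lemma contour_uniq x w : contour x w -> exists w',
  [/\ contour x w', uniq (marks x w') & {subset marks x w' <= marks x w}].
Proof.
have [n] := ubnP (size w); elim: n w => // n IH w ltw cw.
have [uw|] := boolP (uniq (marks x w)); first by exists w; split.
move=> /marks_nuniq[w1 [b [w2 [b' [w3 [wE loop]]]]]].
pose A := rcons w1 (mark b); pose B := rcons w2 (mark b').
have stA s u c : (state s (rcons u (mark c)) == None) ||
    (state s (rcons u (mark c)) == Some true).
  by rewrite -cats1 state_cat /=; case: (state s u) => [[]|].
have cw' : contour x (A ++ w3).
  move: cw; rewrite /contour wE !walk_cat loop !state_cat.
  have := stA (Some false) w1 b; rewrite -/A => /orP[]/eqP ->.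
    by rewrite !state_None.
  have := stA (Some true) w2 b'; rewrite -/B => /orP[]/eqP -> //.
  by rewrite state_None.
have [|w' [cw2 uw' sub]] := IH (A ++ w3) _ cw'.
  by move: ltw; rewrite wE /A !size_cat !size_rcons; lia.
exists w'; split=> // y /sub; rewrite wE !marks_cat loop !mem_cat.
by case/orP=> ->; rewrite ?orbT.
Qed.

(** * Iterates from all ones and the maximal trajectory *)

Fixpoint top_iter (m : site -> 'I_3) (T : nat) : config :=
  if T is T'.+1 then fun i => phi (m i) (top_iter m T') i else fun _ => true.

Lemma phi_mono k (x y : config) i :
  (forall j, x j ==> y j) -> phi k x i ==> phi k y i.
Proof.
move=> xy; rewrite /phi; case: (val k) => [|[|n]] //.
by apply/implyP => /orP[/(implyP (xy _)) ->//|/andP[]];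
  move=> /(implyP (xy _)) -> /(implyP (xy _)) ->; rewrite orbT.
Qed.

Lemma top_iterS m T i : top_iter m T.+1 i ==> top_iter m T i.
Proof.
elim: T i => [|T IH] i; first exact: implybT.
exact: phi_mono.
Qed.

Lemma top_iter_anti m T T' i :
  (T <= T')%N -> top_iter m T' i -> top_iter m T i.
Proof.
move=> /subnKC <-; elim: (T' - T)%N => [|n IH]; rewrite ?addn0 // addnS.
by move=> /(implyP (top_iterS _ _ _)).
Qed.

Lemma trajectory_le_top_iter m (x : config) T i :
  (forall i, x i = phi (m i) x i) -> x i ==> top_iter m T i.
Proof.
by move=> tx; elim: T i => [|T IH] i; [exact: implybT|rewrite tx phi_mono].
Qed.

(** The iterates decrease and dominate every trajectory; their limit is itself a trajectory since
    each rule reads finitely many sites. *)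
Lemma top_eventE {T : Type} (mu : site -> T -> 'I_3) w :
  top_event mu w <-> forall n, top_iter (mu^~ w) n site0.
Proof.
split=> [[x [[tx _] x0]] n|top0].
  exact: (implyP (trajectory_le_top_iter n _ tx)).
pose m := mu^~ w; pose x : config := fun i => `[< forall n, top_iter m n i >].
have xP i : reflect (forall n, top_iter m n i) (x i) by exact: asboolP.
exists x; split; last exact/xP.
split=> [i|y ty i]; last first.
  by apply/implyP => yi; apply/xP => n;
    exact: (implyP (trajectory_le_top_iter n _ ty)).
apply/idP/idP => [/xP xi|phix].
  have {}xi n : phi (m i) (top_iter m n) i by exact: (xi n.+1).
  move: xi; rewrite /phi; case: (val (m i)) => [|[|k]] xi.
  - exact: (xi 0%N).
  (* Once the first disjunct fails at stage [n], it fails at all later stages, so the conjunction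
     holds there, and by monotonicity at every stage. *)
  - apply/orP; have [xd|/asboolPn/existsNP[n /negP an]] :=
      boolP (x (sadd i (0, 0, -1))); first by left.
    have bc k : (n <= k)%N -> top_iter m k (sadd i (0, 1, -1)) /\
        top_iter m k (sadd i (1, 0, -1)).
      move=> nk; have /orP[/(top_iter_anti nk)|/andP//] := xi k.
      by rewrite (negPf an).
    right; apply/andP; split; apply/xP => k;
      have [b c] := bc _ (leq_maxl n k);
      exact: (top_iter_anti (leq_maxr n k)).
  - exact/xP.
apply/xP => -[//|n] /=; apply: (implyP (phi_mono _ _ _)) phix => j.
by apply/implyP => /xP.
Qed.

(** * Time blocks and bad blocks *)

(* The block [y] consists of the sites [fine K y s] with [1 <= s <= K]. *)
Definition fine (K : nat) (y : site) (s : nat) : site :=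
  (y.1.1, y.1.2, y.2 * K%:Z + s%:Z).

(* For [c < K] the certificate says that an error occurs at the [c.+1]-th time
   of the block [y]; for [c = K] it says that the whole block uses [phi_2]. *)
Definition cert (K : nat) (y : site) (c : nat) : seq (site * 'I_3) :=
  if (c < K)%N then [:: (fine K y c.+1, ord0)]
  else [seq (fine K y s.+1, ord_max) | s <- iota 0 K].

Definition holds (m : site -> 'I_3) (L : seq (site * 'I_3)) : Prop :=
  forall q, q \in L -> m q.1 = q.2.

Definition bad (K : nat) (m : site -> 'I_3) (y : site) : Prop :=
  exists c : 'I_K.+1, holds m (cert K y c).

Lemma not_bad K m y : ~ bad K m y ->
  (forall s, (s < K)%N -> val (m (fine K y s.+1)) != 0%N) /\
  exists2 s, (s < K)%N & val (m (fine K y s.+1)) = 1%N.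
Proof.
move=> nb; have err s : (s < K)%N -> val (m (fine K y s.+1)) != 0%N.
  move=> sK; apply: contra_notN nb => /eqP m0.
  exists (Ordinal (leqW sK)); rewrite /cert /= sK => q.
  by rewrite inE => /eqP -> /=; exact: val_inj.
split=> //; apply: contrapT => no1; apply: nb.
exists ord_max; rewrite /cert /= ltnn => q /mapP[s].
rewrite mem_iota => /andP[_ sK] -> /=; apply: val_inj => /=.
have := err _ sK; have := ltn_ord (m (fine K y s.+1)).
have : val (m (fine K y s.+1)) <> 1%N by move=> m1; apply: no1; exists s.
by move: (m _) => [] [|[|[|k]]].
Qed.

Lemma site_eq (x y : site) :
  x.1.1 = y.1.1 -> x.1.2 = y.1.2 -> x.2 = y.2 -> x = y.
Proof. by case: x y => [[a b] c] [[a' b'] c'] /= -> -> ->. Qed.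

Lemma fine_down K y s : sadd (fine K y s.+1) (0, 0, -1) = fine K y s.
Proof. by apply: site_eq; rewrite /= ?addr0 //; lia. Qed.

(** Offset 0 is thus the last time of the block below; zeros pass between blocks through it. *)
Lemma fine_last K y : fine K (sadd y (0, 0, -1)) K = fine K y 0.
Proof. by apply: site_eq; rewrite /= ?addr0 // mulrDl; lia. Qed.

Lemma fine_side K y b s :
  sadd (fine K y s.+1) (sadd (side b) (0, 0, -1)) = fine K (sadd y (side b)) s.
Proof. by apply: site_eq; case: b => /=; rewrite ?addr0 //; lia. Qed.

(** * From a zero to a closed walk marked at bad blocks *)

Lemma zero_down m T i : val (m i) != 0%N -> ~~ top_iter m T.+1 i ->
  ~~ top_iter m T (sadd i (0, 0, -1)).
Proof.
move=> mi; apply: contra => zi; rewrite [top_iter _ _ _]/= /phi.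
by case: (val (m i)) mi => [//|[|k]] _; rewrite zi.
Qed.

Lemma zero_side m T i : val (m i) = 1%N -> ~~ top_iter m T.+1 i ->
  exists b, ~~ top_iter m T (sadd i (sadd (side b) (0, 0, -1))).
Proof.
move=> mi; rewrite [top_iter m T.+1 i]/= /phi mi negb_or negb_and.
case/andP=> _ /orP[] nx.
  by exists false; rewrite (_ : sadd _ (0, 0, -1) = (0, 1, -1)).
by exists true; rewrite (_ : sadd _ (0, 0, -1) = (1, 0, -1)).
Qed.

Lemma zero_descend K m y T s s' : (s' <= s <= K)%N ->
  (forall s, (s < K)%N -> val (m (fine K y s.+1)) != 0%N) ->
  ~~ top_iter m T (fine K y s) ->
  exists2 T', T = (T' + (s - s'))%N & ~~ top_iter m T' (fine K y s').
Proof.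
move=> /andP[ss sK] noerr; elim: s T ss sK => [|s IH] T.
  by rewrite leqn0 => /eqP -> _ zT; exists T; rewrite // addn0.
rewrite leq_eqVlt => /orP[/eqP -> _ zT|]; first by exists T; rewrite ?subnn ?addn0.
rewrite ltnS => ss sK; case: T => [//|T] /(zero_down (noerr _ sK)).
rewrite fine_down => /(IH _ ss (ltnW sK))[T' -> zT']; exists T' => //.
by rewrite -addnS subSn.
Qed.

Lemma state_contour_cat w1 w2 b :
  state (Some false) w1 = Some true -> state (Some false) w2 = Some true ->
  state (Some false) (down b :: w1 ++ slide b :: w2 ++ [:: up]) = Some true.
Proof.
by move=> s1 s2; rewrite [LHS]/= -/(state _ _) state_cat s1 /= -/(state _ _)
  state_cat s2.
Qed.

(** Strong induction on [T]: the zeros found further back in time belong to strictly earlier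
    iterates, and the iterate 0 has no zeros. *)
Lemma zero_contour K m : (0 < K)%N -> forall T y s, (s <= K)%N ->
  ~~ top_iter m T (fine K y s) ->
  exists2 w, contour y w & forall z, z \in marks y w -> bad K m z.
Proof.
move=> K0 T; have [n] := ubnP T; elim: n T => // n IH T.
rewrite ltnS => Tn y s sK zT.
have [by_|/not_bad[noerr _]] := pselect (bad K m y).
  exists [:: mark false].
    apply/andP; split=> //; apply/eqP; apply: site_eq => /=;
      by rewrite ?addr0 ?subr0.
  move=> z; rewrite inE => /eqP ->.
  suff -> : sadd y (step (mark false)) = y by exact: by_.
  by apply: site_eq; rewrite /= ?addr0 ?subr0.
pose y' := sadd y (0, 0, -1).
have sK0 : (0 <= s <= K)%N by [].
have [T0 TE] := zero_descend sK0 noerr zT; rewrite -fine_last -/y' => z0.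
have [by_|/not_bad[noerr' [s1 s1K m1]]] := pselect (bad K m y').
  exists [:: mark true; up].
    apply/andP; split=> //; apply/eqP; apply: site_eq => /=;
      by rewrite ?addr0 ?subrK //; lia.
  move=> z; rewrite inE => /eqP ->.
  suff -> : sadd y (step (mark true)) = y' by exact: by_.
  by apply: site_eq; rewrite /= ?addr0 //; lia.
(* The zero is followed twice through [y']: down to offset 0, and down to an application of [phi_1],
   where it also spreads to a neighbour. *)
have [|T1 T1E z1] := zero_descend (s':=0) _ noerr' z0; first by rewrite leqnn.
have [|T2 T2E z2] := zero_descend (s':=s1.+1) _ noerr' z0.
  by rewrite s1K leqnn.
have [||w2 c2 bad2] := IH T1 _ y' 0%N _ z1; [lia|exact: leq0n|].
case: T2 T2E z2 => // T2 T2E /(zero_side m1)[b].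
rewrite fine_side => z3.
have [||w1 c1 bad1] := IH T2 _ _ _ _ z3; [lia|exact: ltnW|].
have ydown : sadd y (step (down b)) = sadd y' (side b).
  by apply: site_eq; case: b {z3 c1 bad1} => /=; rewrite ?addr0 ?add0r.
have yslide : sadd (sadd y' (side b)) (step (slide b)) = y'.
  by apply: site_eq; case: b {z3 c1 bad1 ydown} => /=; lia.
have yup : sadd y' (step up) = y by apply: site_eq => /=; lia.
have [/andP[/eqP st1 /eqP wk1] /andP[/eqP st2 /eqP wk2]] := (c1, c2).
(* Go to the neighbour one level below, run its contour, slide to [y'], run the contour there, and
   go up to [y]. *)
exists (down b :: w1 ++ slide b :: w2 ++ [:: up]).
  rewrite /contour state_contour_cat // eqxx /=.
  rewrite -/(walk _ _) ydown walk_cat wk1 /= -/(walk _ _) yslide walk_cat.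
  by rewrite wk2 /= yup.
move=> z; rewrite [marks _ _]/= ydown marks_cat wk1 mem_cat => /orP[/bad1//|].
by rewrite [marks _ _]/= yslide marks_cat wk2 mem_cat /= orbF => /bad2.
Qed.

(** * Probability that several blocks are all bad *)

Local Open Scope classical_set_scope.

Lemma measure_le_sum {R : realType} {d : measure_display}
    {Omega : measurableType d} (P : probability Omega R) (I : finType)
    (B : set Omega) (A : I -> set Omega) :
  measurable B -> (forall i, measurable (A i)) ->
  (forall w, B w -> exists i, A i w) -> (P B <= \sum_i P (A i))%E.
Proof.
move=> mB mA BA.
have mU s : measurable (\big[setU/set0]_(i <- s) A i) by exact: bigsetU_measurable.
apply: (@le_trans _ _ (P (\big[setU/set0]_(i <- index_enum I) A i))).
  apply: le_measure; rewrite ?inE // => w /BA[i Ai].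
  by rewrite -bigcup_seq; exists i => //=; rewrite mem_index_enum.
elim: (index_enum I) => [|i s IH]; first by rewrite !big_nil measure0.
rewrite !big_cons; apply: le_trans (measureU2 _ _ _) _ => //.
exact: leeD2l.
Qed.

Section RandomField.
Variables (R : realType) (d : measure_display) (Omega : measurableType d).
Variables (P : probability Omega R) (mu : site -> Omega -> 'I_3) (p r : R).
Hypothesis mu_iid : iid_field P mu p r.
Hypotheses (p01 : 0 <= p <= 1) (r01 : 0 <= r <= 1).

Definition cyl (L : seq (site * 'I_3)) : set Omega := [set w | holds (mu^~ w) L].

Definition weight (L : seq (site * 'I_3)) : R := \prod_(q <- L) law p r q.2.

Lemma law_ge0 k : 0 <= law p r k.
Proof.
move: p01 r01 => /andP[p0 p1] /andP[r0 r1]; rewrite /law.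
by case: (val k) => [|[|n]] //; apply: mulr_ge0; lra.
Qed.

Lemma weight_ge0 L : 0 <= weight L.
Proof. by apply: prodr_ge0 => q _; exact: law_ge0. Qed.

Lemma measurable_cyl L : measurable (cyl L).
Proof.
have -> : cyl L = \bigcap_(q in [set` L]) (mu q.1 @^-1` [set q.2]).
  by apply/seteqP; split.
apply: fin_bigcap_measurable; first exact: finite_seq.
by move=> q _; exact: mu_iid.1.
Qed.

Lemma measure_cyl L : uniq (unzip1 L) -> P (cyl L) = (weight L)%:E.
Proof.
(* Independence is stated for a function on sites, so [L] is turned into a lookup table. *)
move=> uL; pose v i := nth ord0 (unzip2 L) (index i (unzip1 L)).
have vE q : q \in L -> v q.1 = q.2.
  move=> qL; have lt : (index q L < size L)%N by rewrite index_mem.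
  rewrite -(nth_index q qL) /v.
  rewrite -(nth_map _ q.1 fst) // -(nth_map _ ord0 snd) //.
  by rewrite index_uniq ?size_map.
have -> : cyl L = \bigcap_(i in [set` unzip1 L]) (mu i @^-1` [set v i]).
  apply/seteqP; split=> w /= hw.
    by move=> i /mapP[q qL ->] /=; rewrite vE // hw.
  by move=> q qL; rewrite -vE //; apply: hw; rewrite /= map_f.
rewrite mu_iid.2 // big_map; congr EFin.
by apply: eq_big_seq => q /vE ->.
Qed.

Definition all_bad K (S : seq site) : set Omega :=
  [set w | forall y, y \in S -> bad K (mu^~ w) y].

Lemma measurable_all_bad K S : measurable (all_bad K S).
Proof.
have -> : all_bad K S =
    \bigcap_(y in [set` S]) \bigcup_(c in [set: 'I_K.+1]) cyl (cert K y c).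
  apply/seteqP; split=> w /= hw y /= yS.
    by have [c hc] := hw y yS; exists c.
  by have [c _ hc] := hw y yS; exists c.
apply: fin_bigcap_measurable; first exact: finite_seq.
move=> y _; apply: fin_bigcup_measurable; first exact: finite_finset.
by move=> c _; exact: measurable_cyl.
Qed.

Definition bad_weight K : R := K%:R * p + ((1 - p) * (1 - r)) ^+ K.

Lemma sum_weight_cert K y : \sum_(c < K.+1) weight (cert K y c) = bad_weight K.
Proof.
rewrite big_ord_recr /=; congr (_ + _).
  rewrite (eq_bigr (fun=> p)) ?sumr_const ?card_ord ?mulr_natl // => c _.
  by rewrite /weight /cert /= ltn_ord big_seq1.
rewrite /weight /cert ltnn big_map (eq_bigr (fun=> (1 - p) * (1 - r))) //.
by rewrite big_const_seq count_predT size_iota iter_mulr_1.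
Qed.

Lemma fine_inj K y y' s s' : (s < K)%N -> (s' < K)%N ->
  fine K y s.+1 = fine K y' s'.+1 -> y = y' /\ s = s'.
Proof.
move=> sK sK' [e1 e2 e3]; have yy : y.2 = y'.2 by nia.
by split; [exact: site_eq|move: e3; rewrite yy; lia].
Qed.

Lemma mem_cert K y (c : 'I_K.+1) q : q \in cert K y c ->
  exists2 s, (s < K)%N & q.1 = fine K y s.+1.
Proof.
rewrite /cert; case: ifP => [cK|_].
  by rewrite inE => /eqP ->; exists c.
by move=> /mapP[s]; rewrite mem_iota => /andP[_ sK] ->; exists s.
Qed.

Lemma uniq_cert K y (c : 'I_K.+1) : uniq (unzip1 (cert K y c)).
Proof.
rewrite /cert; case: ifP => // _; rewrite /unzip1 -map_comp map_inj_in_uniq.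
  exact: iota_uniq.
by move=> s s' _ _ /= [] /addrI [].
Qed.

(* Independence is only given on cylinders, so bad blocks are replaced one at a
   time by their certificates, which are collected in [L]. *)
Lemma measure_cyl_all_bad K S L : uniq S -> uniq (unzip1 L) ->
  (forall q y s, q \in L -> y \in S -> (s < K)%N -> q.1 <> fine K y s.+1) ->
  (P (cyl L `&` all_bad K S) <= (weight L * bad_weight K ^+ size S)%:E)%E.
Proof.
elim: S L => [|y S IH] L /=.
  move=> _ uL _; rewrite expr0 mulr1 -measure_cyl //.
  apply: le_measure; rewrite ?inE; [|exact: measurable_cyl|by move=> w []].
  by apply: measurableI; [exact: measurable_cyl|exact: measurable_all_bad].
move=> /andP[yS uS] uL dL.
pose A (c : 'I_K.+1) := cyl (L ++ cert K y c) `&` all_bad K S.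
have mA c : measurable (A c).
  by apply: measurableI; [exact: measurable_cyl|exact: measurable_all_bad].
apply: (@le_trans _ _ (\sum_c P (A c))%E).
  apply: measure_le_sum => //.
    by apply: measurableI; [exact: measurable_cyl|exact: measurable_all_bad].
  move=> w [Lw bw]; have [c hc] := bw y (mem_head _ _).
  exists c; split=> [q|z zS]; last by apply: bw; rewrite inE zS orbT.
  by rewrite mem_cat => /orP[/Lw|/hc].
apply: (@le_trans _ _
    (\sum_(c < K.+1) (weight L * bad_weight K ^+ size S * weight (cert K y c))%:E)%E).
  (* Distinct blocks occupy disjoint sites, so the extended list has distinct sites and avoids the
     remaining blocks. *)
  apply: lee_sum => c _; apply: (le_trans (IH _ uS _ _)).
  - rewrite /unzip1 map_cat cat_uniq uL uniq_cert andbT /=.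
    apply/hasPn => i /mapP[q /mem_cert[s sK qs] ->]; apply/negP => /mapP[q' q'L e].
    by apply: (dL q' y s q'L (mem_head _ _) sK); rewrite -e.
  - move=> q z s; rewrite mem_cat => /orP[qL zS|/mem_cert[s' sK' ->] zS sK].
      by apply: dL; rewrite // inE zS orbT.
    by move=> /(fine_inj sK' sK)[yz _]; rewrite yz zS in yS.
  - by rewrite lee_fin /weight big_cat /= mulrAC.
by rewrite sumEFin lee_fin -mulr_sumr sum_weight_cert exprSr mulrA.
Qed.

Lemma measure_all_bad K S : uniq S ->
  (P (all_bad K S) <= (bad_weight K ^+ size S)%:E)%E.
Proof.
move=> uS; have := @measure_cyl_all_bad K S [::] uS isT.
rewrite /weight big_nil mul1r; have -> : cyl [::] = setT by apply/seteqP.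
by rewrite setTI; apply.
Qed.

(** * Measurability and the Peierls sum *)

Lemma measurable_top_iter T i : measurable [set w | top_iter (mu^~ w) T i].
Proof.
elim: T i => [|T IH] i.
  rewrite (_ : [set _ | _] = setT); last by apply/seteqP.
  exact: measurableT.
pose X j := [set w | top_iter (mu^~ w) T j].
pose M k := mu i @^-1` [set k].
have -> : [set w | top_iter (mu^~ w) T.+1 i] =
    (M (inord 1) `&` (X (sadd i (0, 0, -1)) `|`
       (X (sadd i (0, 1, -1)) `&` X (sadd i (1, 0, -1)))))
    `|` (M ord_max `&` X (sadd i (0, 0, -1))).
  apply/seteqP; split=> w; rewrite /M /X /= /phi.
    case muk : (mu i w) => [[|[|[|k]]] lk] //= hx; [left|right]; split=> //.
      by apply: val_inj; rewrite /= inordK.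
    by case/orP: hx => [|/andP]; [left|right].
    exact: val_inj.
  case=> -[-> hx] //.
  rewrite (_ : val (inord 1) = 1%N); last exact: inordK.
  by apply/orP; case: hx => [|/andP]; [left|right].
have mM k : measurable (M k) by exact: mu_iid.1.
have mX j : measurable (X j) by exact: IH.
apply: measurableU; apply: measurableI => //.
by apply: measurableU => //; exact: measurableI.
Qed.

Lemma measurable_top_event : measurable (top_event mu).
Proof.
have -> : top_event mu = \bigcap_T [set w | top_iter (mu^~ w) T site0].
  apply/seteqP; split=> w.
    by move=> /top_eventE h n _; exact: h.
  by move=> h; apply/top_eventE => n; exact: h.
by apply: bigcapT_measurable => T; exact: measurable_top_iter.
Qed.

(** A contour of length n with distinct marks has at least n / 5 of them, so its marks are all bad
    with probability at most [eta ^+ n]; there are 8 ^ n words of length n. *)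
Lemma measure_top_event_ge K (eta e : R) : (0 < K)%N -> 0 <= eta ->
  bad_weight K <= eta ^+ 5 -> 16 * eta <= e -> e <= 1 ->
  ((1 - e)%:E <= P (top_event mu))%E.
Proof.
move=> K0 eta0 bad_le eta_le e1.
have e0 : 0 <= e by lra.
have bad0 : 0 <= bad_weight K.
  by rewrite -(sum_weight_cert K site0) sumr_ge0 // => c _; exact: weight_ge0.
pose F m (w : m.-tuple letter) : set Omega :=
  if contour site0 w && uniq (marks site0 w)
  then all_bad K (marks site0 w) else set0.
have mF m w : measurable (F m w).
  by rewrite /F; case: ifP => // _; exact: measurable_all_bad.
have PF m w : (P (F m w) <= (eta ^+ m)%:E)%E.
  rewrite /F; case: ifP => [/andP[cw uw]|_]; last by rewrite measure0 lee_fin exprn_ge0.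
  apply: (le_trans (measure_all_bad K uw)); rewrite lee_fin.
  apply: (@le_trans _ _ ((eta ^+ 5) ^+ size (marks site0 w))).
    by rewrite lerXn2r ?nnegrE // exprn_ge0.
  rewrite -exprM ler_wiXn2l //; first by lra.
  by have := contour_size cw; rewrite size_tuple.
(* Contours are nonempty, so lengths start at 1. *)
pose G m : set Omega := \bigcup_(w in [set: m.+1.-tuple letter]) F m.+1 w.
have mG m : measurable (G m).
  by apply: fin_bigcup_measurable => //; exact: finite_finset.
have PG m : (P (G m) <= (e / (2 ^ m.+1)%:R)%:E)%E.
  apply: (@le_trans _ _ (\sum_(w : m.+1.-tuple letter) P (F m.+1 w))%E).
    by apply: measure_le_sum => // w [u _ ?]; exists u.
  apply: (@le_trans _ _ (\sum_(w : m.+1.-tuple letter) (eta ^+ m.+1)%:E)%E).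
    by apply: lee_sum => w _; exact: PF.
  rewrite sumEFin lee_fin sumr_const card_tuple !card_prod card_bool.
  rewrite ler_pdivlMr ?ltr0n ?expn_gt0 // -(mulr_natl (eta ^+ _)) !natrX -!exprMn.
  (* The factor 8 counts letters; the last 2 comes from the summable weights. *)
  have -> : (2 * 2 * 2)%:R * eta * 2 = 16 * eta by lra.
  apply: (@le_trans _ _ (e ^+ m.+1)).
    by rewrite lerXn2r ?nnegrE //; lra.
  by rewrite exprS ler_piMr // exprn_ile1.
have mtop := measurable_top_event.
have PC : (P (~` top_event mu) <= e%:E)%E.
  apply: (@le_trans _ _ (\sum_(m <oo) P (G m))%E).
    apply: measure_sigma_subadditive => //; first exact: measurableC.
    move=> w /= ntop.
    have [T zT] : exists T, ~~ top_iter (mu^~ w) T site0.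
      apply: contrapT => /forallNP h; apply: ntop; apply/top_eventE => n.
      by apply/negPn/negP; exact: h.
    have z0 : fine K site0 0 = site0 by apply: site_eq => //=; rewrite mul0r.
    rewrite -z0 in zT.
    have [u cu badu] := zero_contour K0 (leq0n K) zT.
    have [u' [cu' uu' sub]] := contour_uniq cu.
    have u0 := contour_gt0 cu'; case: u' => // l u' in cu' uu' sub u0 *.
    exists (size u') => //; exists (in_tuple (l :: u')) => //.
    by rewrite /F /= cu' uu' => y /sub/badu.
  apply: (@le_trans _ _ (\sum_(m <oo) (e / (2 ^ m.+1)%:R)%:E)%E).
    by apply: lee_nneseries => // m _; exact: PG.
  exact: (epsilon_trick0 xpredT).
have PtopE : P (top_event mu) = (1 - P (~` top_event mu))%E.
  by rewrite -probability_setC ?setCK //; exact: measurableC.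
by rewrite PtopE EFinB leeB.
Qed.

End RandomField.

(** * Choice of the block length and the two limits *)

Lemma bernoulli_ineq {R : realFieldType} (x : R) n :
  0 <= x -> 1 + n%:R * x <= (1 + x) ^+ n.
Proof.
move=> x0; elim: n => [|n IH]; first by rewrite mul0r addr0 expr0.
rewrite exprS -natr1; have n0 : 0 <= n%:R :> R by exact: ler0n.
by nra.
Qed.

(** By Bernoulli, K r <= (1 + r) ^ K, and (1 - r) (1 + r) <= 1. *)
Lemma slow_block_bound {R : realFieldType} (p r : R) K :
  0 <= p <= 1 -> 0 <= r <= 1 -> ((1 - p) * (1 - r)) ^+ K * (K%:R * r) <= 1.
Proof.
move=> /andP[p0 p1] /andP[r0 r1].
have r0' : 0 <= 1 - r by lra.
apply: (@le_trans _ _ ((1 - r) ^+ K * (1 + r) ^+ K)).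
  apply: ler_pM.
  - by apply: exprn_ge0; apply: mulr_ge0; lra.
  - by rewrite mulr_ge0.
  - by apply: lerXn2r; rewrite ?nnegrE //; [apply: mulr_ge0; lra|nra].
  - by apply: le_trans (bernoulli_ineq K r0); lra.
rewrite -exprMn; apply: exprn_ile1; [apply: mulr_ge0; lra|nra].
Qed.

(* With this length, [slow_block_bound] bounds the probability that the block has
   no [phi_1] by [b / 2]. *)
Definition block_length {R : realType} (b r : R) : nat := (Num.truncn (2 / b / r)).+1.

Lemma block_length_ge {R : realType} (b r : R) : 0 < r ->
  2 / b <= (block_length b r)%:R * r.
Proof. by move=> r0; rewrite -ler_pdivrMr // ltW // truncnS_gt. Qed.

Lemma block_length_le {R : realType} (b r : R) : 0 < b -> 0 < r ->
  (block_length b r)%:R * r <= 2 / b + r.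
Proof.
move=> b0 r0; rewrite /block_length -natr1 mulrDl mul1r lerD2r -ler_pdivlMr //.
by rewrite truncn_le // !divr_ge0 // ltW.
Qed.

(** Errors and the absence of [phi_1] each contribute at most half of [b], the fifth power of
    [eta = e / 16]. *)
Lemma rho_ge_block {R : realType} (p r e : R) :
  0 < e <= 1 -> 0 <= p <= 1 -> 0 < r <= 1 ->
  let b := (e / 16) ^+ 5 in (block_length b r)%:R * p <= b / 2 ->
  rho_ge p r (1 - e).
Proof.
move=> /andP[e0 e1] p01 /andP[r0 r1] b Kp d Omega P mu mu_iid.
have b0 : 0 < b by rewrite exprn_gt0 // divr_gt0.
have r01 : 0 <= r <= 1 by rewrite ltW.
pose K := block_length b r; rewrite -/K in Kp.
apply: (@measure_top_event_ge _ _ _ P mu p r mu_iid p01 r01 K (e / 16)) => //;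
  [lra| |lra].
rewrite -/b /bad_weight.
have := slow_block_bound K p01 r01; have Kr := block_length_ge b r0.
rewrite -/K in Kr.
set s := (_ ^+ K) => sK.
have s0 : 0 <= s.
  by apply: exprn_ge0; move: p01 => /andP[p0 p1]; apply: mulr_ge0; lra.
have sb : s <= b / 2.
  have : s * (2 / b) <= 1 by apply: le_trans sK; exact: ler_wpM2l.
  by rewrite -ler_pdivlMr ?divr_gt0 // invf_div mul1r.
by rewrite -/s; lra.
Qed.

Lemma rho_ge_le {R : realType} (p r a a' : R) :
  a <= a' -> rho_ge p r a' -> rho_ge p r a.
Proof.
by move=> aa h d Omega P mu /h; apply: le_trans; rewrite lee_fin.
Qed.

Theorem theorem3 (R : realType) :
  (* (i): lim_{p -> 0} rhobar(p, r) = 1 for each r in (0,1] *)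
  (forall r : R, 0 < r <= 1 ->
     forall eps : R, 0 < eps -> exists delta : R, 0 < delta /\
       forall p : R, 0 < p < delta -> rho_ge p r (1 - eps))
  /\
  (* (ii) *)
  (exists c : R, 0 < c /\
     forall eps : R, 0 < eps -> exists delta : R, 0 < delta /\
       forall r p : R, 0 < r < delta -> 0 <= p <= c * r ^+ 2 ->
         rho_ge p r (1 - eps)).
Proof.
split=> [r r01 eps eps0|].
  have [r0 r1] := andP r01; pose e := Num.min eps 1.
  have e0 : 0 < e by rewrite lt_min eps0 ltr01.
  have [e_eps e1] : e <= eps /\ e <= 1 by rewrite !ge_min !lexx orbT.
  pose b := (e / 16) ^+ 5; pose K := block_length b r.
  have b0 : 0 < b by rewrite exprn_gt0 // divr_gt0.
  have K0 : 0 < K%:R :> R by rewrite ltr0n.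
  (* For fixed [r] the length [K] does not depend on [p]. *)
  exists (Num.min 1 (b / 2 / K%:R)); split.
    by rewrite lt_min ltr01 !divr_gt0.
  move=> p /andP[p0]; rewrite lt_min => /andP[p1 pK].
  apply: (@rho_ge_le _ _ _ _ (1 - e)); first by lra.
  apply: rho_ge_block => //; [by rewrite e0|by rewrite !ltW|].
  by rewrite -/b -/K mulrC -ler_pdivlMr // ltW.
exists 1; split=> // eps eps0; pose e := Num.min eps 1.
have e0 : 0 < e by rewrite lt_min eps0 ltr01.
have [e_eps e1] : e <= eps /\ e <= 1 by rewrite !ge_min !lexx orbT.
pose b := (e / 16) ^+ 5.
have b0 : 0 < b by rewrite exprn_gt0 // divr_gt0.
have A0 : 0 < 2 / b by rewrite divr_gt0.
have A1 : 0 < 2 / b + 1 by lra.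
(* Since K r <= 2 / b + 1 and p <= r ^ 2, K p <= (2 / b + 1) r, which this bound on [r] keeps below
   b / 2. *)
exists (Num.min 1 (b / 2 / (2 / b + 1))); split.
  by rewrite lt_min ltr01 !divr_gt0.
move=> r p /andP[r0]; rewrite lt_min => /andP[r1]; rewrite ltr_pdivlMr // => rb.
rewrite mul1r expr2 => /andP[p0 pr].
apply: (@rho_ge_le _ _ _ _ (1 - e)); first by lra.
have Kr := block_length_le b0 r0.
apply: rho_ge_block => //; [by rewrite e0|by nra|by rewrite r0 ltW|].
rewrite -/b; move: (block_length b r) Kr => K Kr.
have K0 : 0 <= K%:R :> R by exact: ler0n.
apply: (@le_trans _ _ (K%:R * r * r)); first by rewrite -mulrA ler_wpM2l.
apply: (@le_trans _ _ ((2 / b + 1) * r)); last by rewrite mulrC ltW.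
by rewrite ler_wpM2r ?ltW //; lra.
Qed.
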